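(* Let $k\geq 1$ be an integer, and let $\pi=(d_1,\ldots,d_n)$ and $(k_1,\ldots,k_n)$ be sequences of integers such that $\pi$ and $(d_1-k_1,\ldots,d_n-k_n)$ are both graphic, and $d_i\geq 2$ and $k\leq k_i\leq k+1$ for all $i\in\{1,\ldots,n\}$. Then there exists a maximally edge-connected realization of $\pi$ that has a $(k_1,\ldots,k_n)$-factor.
   Context: All graphs are finite and simple. A sequence $(d_1,\ldots,d_n)$ of non-negative integers is graphic if there is a simple graph $G$ with vertex set $\{v_1,\ldots,v_n\}$ such that $\deg_G(v_i)=d_i$ for all $i$; such a $G$ is called a realization of the sequence. (Sequences are not assumed to be ordered.) A realization $G$ has a $(k_1,\ldots,k_n)$-factor if it has a spanning subgraph $H$ with $\deg_H(v_i)=k_i$ for all $i$. A graph $G$ is maximally edge-connected if its edge-connectivity $\lambda(G)$ equals its minimum degree $\delta(G)$. *)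

(* Defs.v *)
From mathcomp Require Import all_boot all_order all_algebra.

Set Implicit Arguments.
Unset Strict Implicit.
Unset Printing Implicit Defensive.

Record sgraph (V : finType) := SGraph {
  adj : rel V;
  adj_sym : symmetric adj;
  adj_irrefl : irreflexive adj
}.

Section Graphs.
Variable V : finType.
Implicit Types (G H : sgraph V) (S : {set {set V}}).

Definition deg G (v : V) : nat := #|[set w | adj G v w]|.

(* An edge is the unordered pair of its ends. *)
Definition edges G : {set {set V}} :=
  [set [set p.1; p.2] | p : V * V & adj G p.1 p.2].

Definition connected G : bool := [forall x, forall y, connect (adj G) x y].

Definition del_adj G S : rel V := fun x y => adj G x y && ([set x; y] \notin S).

Lemma del_adj_sym G S : symmetric (del_adj G S).
Proof. by move=> x y; rewrite /del_adj adj_sym setUC. Qed.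

Lemma del_adj_irrefl G S : irreflexive (del_adj G S).
Proof. by move=> x; rewrite /del_adj adj_irrefl. Qed.

Definition del_edges G S : sgraph V :=
  SGraph (del_adj_sym G S) (del_adj_irrefl G S).

(* The default value #|edges G| matters only when #|V| <= 1, where no set of  *)
(* edges disconnects G; it then gives the usual convention, 0. If #|V| >= 2,  *)
(* then edges G itself is a disconnecting set.                                *)
Definition edge_connectivity G : nat :=
  \big[minn/#|edges G|]_(S : {set {set V}}
      | (S \subset edges G) && ~~ connected (del_edges G S)) #|S|.

(* Every degree is less than #|V|, so the default value #|V| matters only     *)
(* when V is empty.                                                           *)
Definition min_degree G : nat := \big[minn/#|V|]_(v : V) deg G v.

Definition maximally_edge_connected G : Prop :=
  edge_connectivity G = min_degree G.

(* H is spanning because it has the same vertex type as G. *)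
Definition spanning_subgraph H G : Prop := subrel (adj H) (adj G).

End Graphs.

Definition realization n (d : 'I_n -> int) (G : sgraph 'I_n) : Prop :=
  forall i, Posz (deg G i) = d i.

Definition graphic n (d : 'I_n -> int) : Prop :=
  exists G : sgraph 'I_n, realization d G.

Definition has_factor n (k : 'I_n -> int) (G : sgraph 'I_n) : Prop :=
  exists H : sgraph 'I_n,
    spanning_subgraph H G /\ (forall i, Posz (deg H i) = k i).

(* Main.v *)
Require Import Defs.
From mathcomp Require Import all_boot all_order all_algebra zify.

(** The proof combines two exchange arguments, both built on the switch: along
    a 4-cycle a, b, c, d whose edges ab, cd are present and whose edges bc, da
    are absent, replace the former by the latter.  All degrees are kept.

    Existence of a factor (Kundu).  Take realizations G of d and F of d - kk.
    A subgraph F of G is what is wanted, since G minus F then has degrees kk.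
    Call a pair excessive if it lies in F only.  If uv is excessive, and ux, vy
    lie in G only, a switch in G (if xy is not in G) or in F (if xy is in F)
    removes an excessive pair and creates none; so when their number is minimal,
    every such xy lies in G only.  Consider a vertex x on an excessive pair xz
    with as many G-only neighbours as possible and a G-only neighbour w of z.
    Then w is G-only adjacent to z, and to all G-only neighbours of x (with w
    itself traded for x, if w is among them), so it has more of them than x.
    Since the values kk differ by at most one, w is also on an excessive pair,
    against the choice of x ([switch_stable_subgraph]).

    Edge-connectivity.  Keep a pair of a graph G and a factor H.  Suppose that
    all cuts of G have at least l edges, where l is smaller than the minimum
    degree of G, and that some cut has l edges.  The number of l-edge cuts is
    lowered by a switch that removes edges aa', bb' of H (so that the same
    switch applies to G and H; as kk is positive, every vertex has an edge of H)
    and adds ab', a'b, where a, a' are on one side and b, b'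
    on the other side of an l-edge cut.  The switch shrinks only the cuts that
    separate {a, b'} from {a', b}, each by two edges, so it is enough that these
    have at least l + 3 edges ([switch_fewer_cuts]).

    If l = 0, take aa' to be an edge of H that is not a bridge of G; it exists as
    all degrees of G are at least 2.  A cut of the above type splits both the
    side of a, with at least 2 edges, and the side of b, with at least 1.

    If l > 0, let X and Y be disjoint inclusion-minimal l-edge cuts.  As l is
    below the minimum degree, there are vertices a of X and b of Y with no
    neighbours outside X and Y respectively.  By minimality every bipartition of X, or of Y, is crossed by
    at least l/2 + 1 edges.  A cut W splitting both has therefore at least l + 2
    edges, and if it has exactly l + 2, then all of them lie inside X or inside
    Y.  If such a W1 blocks the switch to ab', a'b, then a'b' is not an edge (it
    would cross W1), so the switch to ab, a'b' is possible as well.  If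
    this one is blocked by W2, modify the symmetric difference of W1 and W2
    on X and Y to contain all of Y and nothing of X: the resulting set is
    left by no edge, contradicting l > 0 ([connected_fewer_cuts]). *)

Set Implicit Arguments.
Unset Strict Implicit.
Unset Printing Implicit Defensive.

Section FactorConnectivity.
Variable V : finType.
Implicit Types (G H F : sgraph V) (A B W X Y S Z : {set V}).

(** * Counting edges between vertex sets *)

Lemma deg_gt0_adj G v : 0 < deg G v -> exists w, adj G v w.
Proof. by case/card_gt0P=> w; rewrite inE; exists w. Qed.

(** An edge with both ends in the intersection of [A] and [B] counts twice. All
    inequalities between cuts below are obtained by comparing the contributions
    of a single ordered pair, according to the sets that contain its ends. *)
Definition link G A B : nat :=
  \sum_(p : V * V) [&& adj G p.1 p.2, p.1 \in A & p.2 \in B].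

Definition cut G W := link G W (~: W).

Lemma link_sym G A B : link G A B = link G B A.
Proof.
rewrite /link (reindex_inj (h := fun p : V * V => (p.2, p.1))) /=; last first.
  by move=> [? ?] [? ?] [-> ->].
by apply: eq_bigr => -[x y] _ /=; rewrite adj_sym [in RHS]andbA andbAC -andbA.
Qed.

Lemma cutC G W : cut G (~: W) = cut G W.
Proof. by rewrite /cut setCK link_sym. Qed.

Lemma link_gt0 G A B x y :
  adj G x y -> x \in A -> y \in B -> 0 < link G A B.
Proof.
move=> xy xA yB; rewrite /link (bigD1 (x, y)) //=.
by rewrite xy xA yB.
Qed.

Lemma link_eq0 G A B x y :
  link G A B = 0 -> adj G x y -> x \in A -> y \notin B.
Proof.
move=> l0 xy xA; apply/negP=> yB.
by have := link_gt0 xy xA yB; rewrite l0.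
Qed.

Lemma link0 G A B :
  (forall x y, adj G x y -> x \in A -> y \notin B) -> link G A B = 0.
Proof.
move=> h; apply: big1 => -[x y] _ /=.
by case: (boolP (adj G x y)) => //= /h; case: (x \in A) => //= /(_ isT)/negbTE->.
Qed.

Lemma link_vertices G A B :
  link G A B = \sum_(x in A) #|[set y in B | adj G x y]|.
Proof.
rewrite /link -(pair_bigA _ (fun x y => [&& adj G x y, x \in A & y \in B] : nat)) /=.
rewrite [RHS]big_mkcond; apply: eq_bigr => x _ /=.
case: (x \in A) => /=; last by apply: big1 => y _; rewrite andbF.
rewrite -sum1dep_card [RHS]big_mkcond; apply: eq_bigr => y _ /=.
by rewrite andbC; case: (_ && _).
Qed.

Lemma deg_link G v : deg G v = link G [set v] setT.
Proof.
rewrite link_vertices big_set1 /deg; apply: eq_card => w.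
by rewrite !inE.
Qed.

Lemma cut_split G X W :
  cut G (X :&: W) + cut G (X :\: W)
    = cut G X + (link G (X :&: W) (X :\: W)).*2.
Proof.
rewrite -addnn {2}(link_sym G (X :&: W)) /cut /link -!big_split /=.
apply: eq_bigr => -[x y] _ /=; rewrite !inE.
by case: (adj G x y); case: (x \in X); case: (y \in X); case: (x \in W); case: (y \in W).
Qed.

Lemma cut_out G X W :
  cut G (X :&: W) = link G (X :&: W) (X :\: W) + link G (X :&: W) (~: X).
Proof.
rewrite /cut /link -!big_split /=.
apply: eq_bigr => -[x y] _ /=; rewrite !inE.
by case: (adj G x y); case: (x \in X); case: (y \in X); case: (x \in W); case: (y \in W).
Qed.

Lemma out_split G X W :
  link G (X :&: W) (~: X) + link G (X :&: ~: W) (~: X) = cut G X.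
Proof.
rewrite /cut /link -!big_split /=.
apply: eq_bigr => -[x y] _ /=; rewrite !inE.
by case: (adj G x y); case: (x \in X); case: (y \in X); case: (x \in W).
Qed.

Definition crosses_off G X Y W x y :=
  [&& adj G x y, x \in W, y \notin W, ~~ ((x \in X) && (y \in X)) &
      ~~ ((x \in Y) && (y \in Y))].

(** Cut edges are classified into those inside [X], those inside [Y] and the
    rest; a set [W] whose cut is as small as the first two terms allow is
    crossed by no other edge. *)
Lemma cut_inside_disjoint G X Y W : [disjoint X & Y] ->
  cut G W = link G (X :&: W) (X :\: W) + link G (Y :&: W) (Y :\: W)
            + \sum_(p : V * V) crosses_off G X Y W p.1 p.2.
Proof.
move=> dXY; rewrite /cut /link -!big_split /=.
apply: eq_bigr => -[x y] _ /=; rewrite /crosses_off !inE.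
have := disjointFr dXY (x := x); have := disjointFr dXY (x := y).
case: (adj G x y); case: (x \in X); case: (y \in X); case: (x \in W);
  case: (y \in W); case: (x \in Y); case: (y \in Y) => //= h1 h2;
  first [by have := h1 isT | by have := h2 isT].
Qed.

(** Submodularity of the cut function of the subgraph induced by [X]. *)
Lemma inside_submod G X W1 W2 :
  link G (X :&: (W1 :&: W2)) (X :\: (W1 :&: W2)) +
  link G (X :&: (W1 :|: W2)) (X :\: (W1 :|: W2)) <=
  link G (X :&: W1) (X :\: W1) + link G (X :&: W2) (X :\: W2).
Proof.
rewrite /link -!big_split /=.
apply: leq_sum => -[x y] _ /=; rewrite !inE.
by case: (adj G x y); case: (x \in X); case: (y \in X); case: (x \in W1);
  case: (y \in W1); case: (x \in W2); case: (y \in W2).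
Qed.

Definition symdiff A B := (A :\: B) :|: (B :\: A).

Lemma out_symdiff G X W1 W2 :
  link G (X :&: (W1 :|: W2)) (~: X) =
  link G (X :&: (W1 :&: W2)) (~: X) + link G (X :&: symdiff W1 W2) (~: X).
Proof.
rewrite /link -!big_split /=.
apply: eq_bigr => -[x y] _ /=; rewrite !inE.
by case: (adj G x y); case: (x \in X); case: (y \in X); case: (x \in W1);
  case: (x \in W2).
Qed.

(** Otherwise each vertex of [X] has an edge leaving [X]; for a fixed [x] in [X],
    the neighbours inside [X] have leaving edges of their own, which together
    with those leaving from [x] make up at least [deg G x] edges. *)
Lemma interior_vertex G X d : X != set0 -> (forall v, d <= deg G v) ->
  cut G X < d -> exists2 a, a \in X & forall w, adj G a w -> w \in X.
Proof.
move=> /set0Pn [x xX] dd cX.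
have [/existsP [a /andP [aX /forallP h]]|/existsPn h] :=
  boolP [exists a, (a \in X) && [forall w, adj G a w ==> (w \in X)]].
  by exists a => // w aw; have /implyP := h w; apply.
exfalso; move: cX; apply/negP; rewrite -leqNgt; apply: leq_trans (dd x) _.
rewrite /cut link_vertices (bigD1 x) //=.
have -> : deg G x = #|[set y in ~: X | adj G x y]| + #|[set y in X | adj G x y]|.
  rewrite /deg -(cardsID (~: X)) addnC [RHS]addnC; congr (_ + _);
    by apply: eq_card => y; rewrite !inE ?negbK // andbC.
rewrite leq_add2l; apply: (@leq_trans #|X :\ x|).
  apply: subset_leq_card; apply/subsetP => y; rewrite !inE => /andP [-> xy].
  by rewrite andbT; apply: contraTneq xy => ->; rewrite adj_irrefl.
rewrite -sum1_card (eq_bigl (fun i => (i \in X) && (i != x))); last first.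
  by move=> i; rewrite !inE andbC.
apply: leq_sum => i /andP [iX _].
have := h i; rewrite iX /= negb_forall => /existsP [w].
rewrite negb_imply => /andP [iw wX].
by apply/card_gt0P; exists w; rewrite !inE wX iw.
Qed.

(** * Switching along an alternating 4-cycle *)

Definition same_pair (a b x y : V) : bool :=
  (x == a) && (y == b) || (x == b) && (y == a).

(** The edges ab, cd become bc, da.  Testing [x != y] makes the result
    irreflexive for all arguments, so that [switch] is a total operation. *)
Definition switch_adj G (a b c d : V) : rel V := fun x y =>
  (x != y) && (same_pair b c x y || same_pair d a x y ||
    adj G x y && ~~ same_pair a b x y && ~~ same_pair c d x y).

Lemma same_pairC a b x y : same_pair a b x y = same_pair a b y x.
Proof. by rewrite /same_pair orbC andbC [in X in _ || X]andbC. Qed.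

Lemma switch_sym G a b c d : symmetric (switch_adj G a b c d).
Proof.
move=> x y; rewrite /switch_adj eq_sym adj_sym.
by rewrite (same_pairC b) (same_pairC d) (same_pairC a) (same_pairC c).
Qed.

Lemma switch_irrefl G a b c d : irreflexive (switch_adj G a b c d).
Proof. by move=> x; rewrite /switch_adj eqxx. Qed.

Definition switch G a b c d :=
  SGraph (switch_sym G a b c d) (switch_irrefl G a b c d).

Definition switchable G a b c d :=
  [&& adj G a b, adj G c d, ~~ adj G b c, ~~ adj G d a, b != c & d != a].

(** The additive form of the exchange, with no subtraction, can be summed over any
    family of pairs; degrees and cuts are both handled by it. *)
Lemma switch_adjE G a b c d x y : switchable G a b c d ->
  adj (switch G a b c d) x y + same_pair a b x y + same_pair c d x y
  = adj G x y + same_pair b c x y + same_pair d a x y.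
Proof.
case/and5P=> ab cd bc da /andP [nbc nda].
have nac : a != c by apply: contraTneq ab => ->; rewrite adj_sym.
have nbd : b != d by apply: contraTneq ab => ->; rewrite adj_sym.
have nab : a != b by apply: contraTneq ab => ->; rewrite adj_irrefl.
have ncd : c != d by apply: contraTneq cd => ->; rewrite adj_irrefl.
have hab : same_pair a b x y -> adj G x y by
  case/orP=> /andP [/eqP-> /eqP->] //; rewrite adj_sym.
have hcd : same_pair c d x y -> adj G x y by
  case/orP=> /andP [/eqP-> /eqP->] //; rewrite adj_sym.
have hbc : same_pair b c x y -> ~~ adj G x y by
  case/orP=> /andP [/eqP-> /eqP->] //; rewrite adj_sym.
have hda : same_pair d a x y -> ~~ adj G x y by
  case/orP=> /andP [/eqP-> /eqP->] //; rewrite adj_sym.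
have ebc : same_pair b c x y -> x != y by
  case/orP=> /andP [/eqP-> /eqP->] //; rewrite eq_sym.
have eda : same_pair d a x y -> x != y by
  case/orP=> /andP [/eqP-> /eqP->] //; rewrite eq_sym.
have exy : adj G x y -> x != y by
  apply: contraTneq => ->; rewrite adj_irrefl.
have d1 : same_pair a b x y -> ~~ same_pair c d x y.
  by case/orP=> /andP [/eqP-> /eqP->];
    rewrite /same_pair ?(negbTE nac) ?(negbTE nbd) ?(negbTE nbc) ?andbF.
have d2 : same_pair b c x y -> ~~ same_pair d a x y.
  by case/orP=> /andP [/eqP-> /eqP->];
    rewrite /same_pair ?(negbTE nbd) ?(negbTE ncd) ?andbF.
move/implyP: hab; move/implyP: hcd; move/implyP: hbc; move/implyP: hda.
move/implyP: ebc; move/implyP: eda; move/implyP: exy; move/implyP: d1.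
move/implyP: d2; rewrite /= /switch_adj.
by case: (adj G x y); case: (same_pair a b x y); case: (same_pair b c x y);
  case: (same_pair c d x y); case: (same_pair d a x y); case: (x != y).
Qed.

(** The contribution of the edge xy to [link G A B]. *)
Definition ends A B x y : nat :=
  ((x \in A) && (y \in B)) + ((y \in A) && (x \in B)).

Lemma sum_same_pair A B a b : a != b ->
  \sum_(p : V * V) [&& same_pair a b p.1 p.2, p.1 \in A & p.2 \in B] = ends A B a b.
Proof.
move=> nab; rewrite (bigD1 (a, b)) //= (bigD1 (b, a)) /=; last first.
  by rewrite xpair_eqE negb_and eq_sym nab.
rewrite big1 ?addn0; last first.
  move=> [x y] /=; rewrite /same_pair !xpair_eqE.
  by do 4!case: (_ == _).
by rewrite /same_pair !eqxx orbT.
Qed.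

Lemma link_switch G a b c d A B : switchable G a b c d ->
  link (switch G a b c d) A B + ends A B a b + ends A B c d
  = link G A B + ends A B b c + ends A B d a.
Proof.
move=> sw; case/and5P: (sw)=> ab cd bc da /andP [nbc nda].
have nab : a != b by apply: contraTneq ab => ->; rewrite adj_irrefl.
have ncd : c != d by apply: contraTneq cd => ->; rewrite adj_irrefl.
rewrite -!sum_same_pair // /link -!big_split; apply: eq_bigr => -[x y] _.
have := switch_adjE x y sw; rewrite [adj]lock /= -lock.
by case: (x \in A); case: (y \in B); rewrite ?andbT ?andbF.
Qed.

Lemma deg_switch G a b c d v : switchable G a b c d ->
  deg (switch G a b c d) v = deg G v.
Proof.
move=> sw; rewrite !deg_link; have := link_switch [set v] setT sw.
rewrite /ends !inE; lia.
Qed.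

(** * Kundu's k-factor theorem *)

Definition only G F v : {set V} := [set w | adj G v w && ~~ adj F v w].

Lemma only_sym G F v w : (w \in only G F v) = (v \in only G F w).
Proof. by rewrite !inE adj_sym (adj_sym F). Qed.

Lemma card_only G F v : #|only G F v| + deg F v = #|only F G v| + deg G v.
Proof.
have split_deg (K L : sgraph V) :
    deg K v = #|[set w | adj K v w && adj L v w]| + #|only K L v|.
  rewrite /deg -(cardsID [set w | adj L v w]); congr (_ + _);
    by apply: eq_card => w; rewrite !inE // andbC.
rewrite (split_deg F G) (split_deg G F) addnCA [RHS]addnCA (addnC #|only F G v|).
by congr (_ + _); apply: eq_card => w; rewrite !inE andbC.
Qed.

(** The ordered pairs adjacent in [F] but not in [G]: the obstruction to [F]
    being a subgraph of [G], which the switches below shrink. *)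
Definition excess G F : {set V * V} := [set p | adj F p.1 p.2 && ~~ adj G p.1 p.2].

Lemma switch_removes G a b c d x y : switchable G a b c d ->
  adj G x y -> ~~ adj (switch G a b c d) x y -> same_pair a b x y || same_pair c d x y.
Proof.
move=> sw xy; have := switch_adjE x y sw; rewrite xy.
by case: (adj (switch _ _ _ _ _) x y); case: (same_pair a b x y);
  case: (same_pair c d x y).
Qed.

Lemma switch_adds G a b c d x y : switchable G a b c d ->
  ~~ adj G x y -> adj (switch G a b c d) x y -> same_pair b c x y || same_pair d a x y.
Proof.
move=> sw xy; have := switch_adjE x y sw; rewrite (negbTE xy).
by case: (adj (switch _ _ _ _ _) x y); case: (same_pair b c x y);
  case: (same_pair d a x y).
Qed.

Lemma same_pair_adj G a b x y : same_pair a b x y -> adj G x y = adj G a b.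
Proof. by case/orP=> /andP [/eqP-> /eqP->] //; rewrite adj_sym. Qed.

(** The removed edges ab, cd are not in [F], so no pair of [F] is lost by [G],
    while the pair da of [F] is gained. *)
Lemma excess_switch_left G F a b c d : switchable G a b c d ->
  ~~ adj F a b -> ~~ adj F c d -> adj F d a ->
  #|excess (switch G a b c d) F| < #|excess G F|.
Proof.
move=> sw Fab Fcd Fda; case/and5P: (sw) => ab cd bc da /andP [nbc nda].
apply/proper_card/properP; split.
  apply/subsetP => -[x y]; rewrite !inE [adj (switch _ _ _ _ _)]lock /= -lock.
  case/andP=> Fxy nxy; rewrite Fxy; apply: contraTN Fxy => xy.
  by have /orP [] := switch_removes sw xy nxy => /same_pair_adj ->.
exists (d, a); rewrite !inE /= Fda // /switch_adj nda.
by rewrite {2}/same_pair !eqxx orbT.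
Qed.

(** Dually, [F] gives up the pair ab outside [G], and gains only pairs of [G]. *)
Lemma excess_switch_right G F a b c d : switchable F a b c d ->
  ~~ adj G a b -> adj G b c -> adj G d a ->
  #|excess G (switch F a b c d)| < #|excess G F|.
Proof.
move=> sw Gab Gbc Gda; case/and5P: (sw) => ab cd bc da /andP [nbc nda].
apply/proper_card/properP; split.
  apply/subsetP => -[x y]; rewrite !inE [adj (switch _ _ _ _ _)]lock /= -lock.
  case/andP=> xy nxy; rewrite nxy andbT; apply: contraNT nxy => nxy.
  by have /orP [] := switch_adds sw nxy xy => /same_pair_adj ->.
exists (a, b); first by rewrite !inE /= ab.
rewrite !inE /= /switch_adj.
have -> : same_pair a b a b by rewrite /same_pair !eqxx.
have -> : same_pair b c a b = false.
  by apply: contraNF bc => /(same_pair_adj F) <-.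
have -> : same_pair d a a b = false.
  by apply: contraNF da => /(same_pair_adj F) <-.
by rewrite /= !andbF.
Qed.

(** What remains true when no switch in [G] or in [F] reduces the excess. *)
Definition switch_stable G F := forall u v x y, v \in only F G u ->
  x \in only G F u -> y \in only G F v -> x != y -> y \in only G F x.

(** If xy violates stability, then either xy is absent from [G] and the 4-cycle
    u, x, y, v can be switched in [G], or xy is present in [F] and the 4-cycle
    u, v, y, x can be switched in [F]. *)
Lemma excess_decreases_or_stable G F :
  (exists G' F', [/\ deg G' =1 deg G, deg F' =1 deg F &
     #|excess G' F'| < #|excess G F|]) \/ switch_stable G F.
Proof.
have [/forallP h|] := boolP [forall u, forall v, forall x, forall y,
  [&& v \in only F G u, x \in only G F u, y \in only G F v & x != y] ==>
  (y \in only G F x)].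
  right=> u v x y uv ux vy xy; have /forallP/(_ v)/forallP/(_ x)/forallP/(_ y) := h u.
  by rewrite uv ux vy xy.
rewrite negb_forall => /existsP [u]; rewrite negb_forall => /existsP [v].
rewrite negb_forall => /existsP [x]; rewrite negb_forall => /existsP [y].
rewrite negb_imply => /andP [/and4P [uv ux vy xy] nxy]; left.
move: uv ux vy nxy; rewrite !inE => /andP [Fuv Guv] /andP [Gux Fux] /andP [Gvy Fvy].
have nuv : v != u by apply: contraTneq Fuv => ->; rewrite adj_irrefl.
have nux : x != u by apply: contraTneq Gux => ->; rewrite adj_irrefl.
have nvy : v != y by apply: contraTneq Gvy => ->; rewrite adj_irrefl.
rewrite negb_and negbK; case: (boolP (adj G x y)) => [Gxy /= Fxy|Gxy _].
  have sw : switchable F u v y x.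
    by rewrite /switchable Fuv adj_sym Fxy Fvy adj_sym Fux nvy nux.
  exists G, (switch F u v y x); split=> //; first by move=> w; apply: deg_switch.
  by apply: excess_switch_right; rewrite // adj_sym.
have sw : switchable G u x y v.
  by rewrite /switchable Gux adj_sym Gvy Gxy adj_sym Guv xy nuv.
exists (switch G u x y v), F; split=> //; first by move=> w; apply: deg_switch.
by apply: excess_switch_left; rewrite // adj_sym.
Qed.

(** The extremal vertex is chosen among the ends of excessive pairs.  The identity
    [cE] links the two kinds of neighbours, and is what makes the vertex [w],
    having more of the first kind than [x], also have one of the second: here
    the bound on the spread of [kv] is used. *)
Lemma switch_stable_subgraph (k : nat) (kv : V -> nat) G F :
  (forall v, k <= kv v <= k.+1) -> (forall v, deg G v = deg F v + kv v) ->
  switch_stable G F -> spanning_subgraph F G.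
Proof.
move=> kk dGF irr.
have cE v : #|only G F v| = #|only F G v| + kv v.
  by have := card_only G F v; rewrite dGF; lia.
have [allZ|] := boolP [forall v, only F G v == set0].
  move=> u v Fuv; apply: contraTT isT => Guv.
  have /forallP/(_ u)/eqP/setP/(_ v) := allZ.
  by rewrite !inE Fuv Guv.
rewrite negb_forall => /existsP [x0 Px0].
exfalso.
case: (arg_maxnP (P := fun v => only F G v != set0) (fun v => #|only G F v|) Px0).
move=> x /set0Pn [z xz] maxx.
have zx : x \in only F G z by rewrite only_sym.
have [w zw] : exists w, w \in only G F z.
  apply/set0Pn; rewrite -card_gt0 cE ltn_addr // card_gt0.
  by apply/set0Pn; exists x.
have wz : z \in only G F w by rewrite only_sym.
have nz : (z \in only G F x) = false.
  by move: xz; rewrite !inE => /andP [_ /negbTE ->].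
have lt : #|only G F x| < #|only G F w|.
  have sub y : y \in only G F x -> y != w -> y \in only G F w.
    by move=> xy yw; apply: (irr z x w y); rewrite // eq_sym.
  have [xw|xw] := boolP (w \in only G F x).
    have wx : x \in only G F w by rewrite only_sym.
    have : z |: (x |: (only G F x :\ w)) \subset only G F w.
      apply/subsetP => y; rewrite in_setU1 => /orP [/eqP -> //|].
      rewrite in_setU1 => /orP [/eqP -> //|]; rewrite in_setD1 => /andP [yw xy].
      exact: sub.
    move/subset_leq_card; rewrite !cardsU1 (cardsD1 w (only G F x)) xw.
    have -> : (x \in only G F x :\ w) = false.
      by rewrite !inE adj_irrefl andbF.
    have -> : (z \in x |: only G F x :\ w) = false.
      rewrite in_setU1 in_setD1 nz andbF orbF; apply: contraTF xz => /eqP ->.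
      by rewrite inE adj_irrefl.
    by [].
  have : z |: only G F x \subset only G F w.
    apply/subsetP => y; rewrite in_setU1 => /orP [/eqP -> //|xy].
    by apply: sub => //; apply: contraNneq xw => <-.
  by move/subset_leq_card; rewrite cardsU1 nz.
have : #|only G F w| <= #|only G F x|.
  apply: maxx; rewrite -card_gt0.
  have z0 : 0 < #|only F G x| by rewrite card_gt0; apply/set0Pn; exists z.
  move: lt (kk x) (kk w) z0; rewrite !cE; clear; lia.
by rewrite leqNgt lt.
Qed.

Lemma kundu_k_factor (k : nat) (kv : V -> nat) G F :
  (forall v, k <= kv v <= k.+1) -> (forall v, deg G v = deg F v + kv v) ->
  exists G' F', [/\ deg G' =1 deg G, deg F' =1 deg F & spanning_subgraph F' G'].
Proof.
move=> kk; have [m] := ubnP #|excess G F|; elim: m G F => // m IH G F lt dGF.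
have [[G1 [F1 [eG eF lt1]]]|irr] := excess_decreases_or_stable G F; last first.
  by exists G, F; split=> //; apply: (switch_stable_subgraph kk dGF irr).
have [||G2 [F2 [eG2 eF2 sub]]] := IH G1 F1.
- by apply: leq_trans lt1 _; rewrite -ltnS.
- by move=> v; rewrite eG eF.
exists G2, F2; split=> //.
  by move=> v; rewrite eG2 eG.
by move=> v; rewrite eF2 eF.
Qed.

(** The complement of [F] in [G] is the factor when [F] is a subgraph of [G]. *)
Definition diff_adj G F : rel V := fun x y => adj G x y && ~~ adj F x y.

Lemma diff_sym G F : symmetric (diff_adj G F).
Proof. by move=> x y; rewrite /diff_adj !(adj_sym _ x y). Qed.

Lemma diff_irrefl G F : irreflexive (diff_adj G F).
Proof. by move=> x; rewrite /diff_adj adj_irrefl. Qed.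

Definition diff G F := SGraph (diff_sym G F) (diff_irrefl G F).

Lemma deg_diff G F v : spanning_subgraph F G -> deg (diff G F) v + deg F v = deg G v.
Proof.
move=> FG; have := card_only G F v.
have -> : only F G v = set0.
  by apply/setP => w; rewrite !inE; case: (boolP (adj F v w)) => // /FG ->.
by rewrite cards0.
Qed.

(** * Small cuts and switches that remove them *)

(** Edge-connectivity in its cut form, which is the one that switches control. *)
Definition edge_connected l G :=
  forall W, W != set0 -> W != setT -> l <= cut G W.

(** Each cut is counted twice here, once for each of its sides. *)
Definition cuts_of_size l G :=
  [set W | [&& W != set0, W != setT & cut G W == l]].

Lemma spanning_switch H G a b c d : spanning_subgraph H G ->
  spanning_subgraph (switch H a b c d) (switch G a b c d).
Proof.
move=> HG x y; rewrite /= /switch_adj => /andP [-> /=].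
case/orP=> [-> //|/andP [/andP [/HG -> -> ->]]]; exact: orbT.
Qed.

(** The outcome of one improvement step, common to the cases [l = 0] and [0 < l]. *)
Definition has_fewer_cuts l G H :=
  exists G' H',
    [/\ deg G' =1 deg G, deg H' =1 deg H, spanning_subgraph H' G',
        edge_connected l G' & #|cuts_of_size l G'| < #|cuts_of_size l G|].

(** A cut loses edges only if it alternates around the 4-cycle a, a', b, b', and
    then it loses two; the last hypothesis keeps such cuts above [l].  The cut [Z] gains two
    edges and stops being a cut of size [l]. *)
Lemma switch_fewer_cuts l G H Z a a' b b' :
  spanning_subgraph H G -> edge_connected l G -> cut G Z = l ->
  a \in Z -> a' \in Z -> b \notin Z -> b' \notin Z ->
  adj H a a' -> adj H b b' -> ~~ adj G a' b -> ~~ adj G b' a ->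
  (forall W, a \in W -> b' \in W -> a' \notin W -> b \notin W ->
     l + 3 <= cut G W) ->
  has_fewer_cuts l G H.
Proof.
move=> HG lG cZ aZ a'Z bZ b'Z Haa Hbb Ga'b Gb'a bad.
have na'b : a' != b by apply: contraNneq bZ => <-.
have nb'a : b' != a by apply: contraNneq b'Z => ->.
have swG : switchable G a a' b b'.
  by rewrite /switchable (HG _ _ Haa) (HG _ _ Hbb) Ga'b Gb'a na'b nb'a.
have swH : switchable H a a' b b'.
  rewrite /switchable Haa Hbb na'b nb'a.
  by rewrite !(contra (@HG _ _)).
have key W : cut G W <= cut (switch G a a' b b') W
             \/ l < cut (switch G a a' b b') W.
  move: (link_switch W (~: W) swG) (bad W) (bad (~: W)).
  rewrite -!/(cut _ W) cutC /ends !inE !negbK.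
  move: (cut G W) (cut _ W) => c c'; clear.
  by case: (a \in W); case: (a' \in W); case: (b \in W);
    case: (b' \in W) => /= eq_c h1 h2;
    try (have {}h1 := h1 isT isT isT isT); try (have {}h2 := h2 isT isT isT isT); lia.
have l' : edge_connected l (switch G a a' b b').
  move=> W W0 WT; case: (key W) => [|/ltnW //]; exact/leq_trans/lG.
exists (switch G a a' b b'), (switch H a a' b b'); split => //.
- by move=> v; apply: deg_switch.
- by move=> v; apply: deg_switch.
- exact: spanning_switch.
have Z0 : Z != set0 by apply/set0Pn; exists a.
have ZT : Z != setT by apply: contraNneq bZ => ->; rewrite inE.
apply: proper_card; apply/properP; split.
  apply/subsetP => W; rewrite !inE => /and3P [W0 WT /eqP cW].
  rewrite W0 WT /= eqn_leq lG // andbT; case: (key W); rewrite cW //.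
  by rewrite ltnn.
exists Z; first by rewrite inE Z0 ZT cZ /=.
rewrite inE Z0 ZT /=.
have := link_switch Z (~: Z) swG; rewrite -!/(cut _ Z) /ends !inE.
rewrite aZ a'Z (negbTE bZ) (negbTE b'Z) cZ /= !addn0 => ->.
by rewrite -addnA -[X in _ == X]addn0 eqn_add2l.
Qed.

Lemma cut_ge_inside G X W : link G (X :&: W) (X :\: W) <= cut G W.
Proof.
apply: leq_sum => -[x y] _ /=; rewrite !inE.
by case: (adj G x y); case: (x \in X); case: (y \in X); case: (x \in W);
  case: (y \in W).
Qed.

Lemma cut_ge_inside_both G X W :
  link G (X :&: W) (X :\: W) + link G (~: X :&: W) (~: X :\: W) <= cut G W.
Proof.
rewrite (cut_inside_disjoint G W (X := X) (Y := ~: X)) ?leq_addr //.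
by rewrite -setI_eq0 setICr.
Qed.

(** Let [S] be a minimal set left by at most one edge.  Some vertex [a] of [S] has
    all its neighbours in [S], so some edge [aa'] of [H] lies in [S].  Were it a
    bridge, it would split [S] in two parts left by at most 3 edges in
    total, one of which would contradict minimality. *)
Lemma non_bridge_edge G H :
  spanning_subgraph H G -> V -> (forall v, 1 < deg G v) ->
  (forall v, 0 < deg H v) ->
  exists a a', adj H a a' /\
    forall W, a \in W -> a' \notin W -> 1 < cut G W.
Proof.
move=> HG v0 d2 h1.
pose P S := (S != set0) && (cut G S <= 1).
have PT : P setT.
  rewrite /P; apply/andP; split; first by apply/set0Pn; exists v0.
  by rewrite /cut setCT link0 // => x y _ _; rewrite inE.
case: (arg_minnP (fun S : {set V} => #|S|) PT) => S /andP [S0 cS] minS.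
have [a aS Na] := interior_vertex S0 d2 cS.
have [a' aa'] := deg_gt0_adj (h1 a); exists a, a'; split=> // W aW a'W.
have a'S := Na _ (HG _ _ aa').
rewrite ltnNge; apply/negP => cW.
have := cut_split G S W; have := leq_trans (cut_ge_inside G S W) cW.
move=> i1 cs.
have [c1|c1] : cut G (S :&: W) <= 1 \/ cut G (S :\: W) <= 1 by lia.
  have := minS (S :&: W); rewrite /P c1 andbT.
  have -> : S :&: W != set0 by apply/set0Pn; exists a; rewrite inE aS.
  move/(_ isT); apply/negP; rewrite -ltnNge; apply: proper_card.
  apply/properP; split; first exact: subsetIl.
  by exists a'; rewrite // inE negb_and a'W orbT.
have := minS (S :\: W); rewrite /P c1 andbT.
have -> : S :\: W != set0 by apply/set0Pn; exists a'; rewrite !inE a'W.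
move/(_ isT); apply/negP; rewrite -ltnNge; apply: proper_card.
apply/properP; split; first exact: subsetDl.
by exists a; rewrite // inE aW.
Qed.

(** With the edge of [H] on one side of [Z] not a bridge, any edge of [H] on the
    other side will do: a cut alternating around the 4-cycle has at least two
    edges inside [Z] and one outside. *)
Lemma disconnected_fewer_cuts G H Z :
  spanning_subgraph H G -> (forall v, 1 < deg G v) ->
  (forall v, 0 < deg H v) ->
  Z != set0 -> Z != setT -> cut G Z = 0 -> has_fewer_cuts 0 G H.
Proof.
move=> HG d2 h1 Z0 ZT cZ.
have [v0 _] := set0Pn _ Z0.
have [a [a' [aa' nb]]] := non_bridge_edge HG v0 d2 h1.
wlog aZ : Z Z0 ZT cZ / a \in Z.
  move=> th; case aZ : (a \in Z); first exact: (th Z).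
  apply: (th (~: Z)); rewrite ?cutC ?inE ?aZ //.
    by apply: contraNneq ZT => h; rewrite -(setCK Z) h setC0.
  by apply: contraNneq Z0 => h; rewrite -(setCK Z) h setCT.
have [b bZ] : exists b, b \notin Z.
  by apply/existsP; rewrite -negb_forall; apply: contra ZT => /forallP h;
   apply/eqP/setP => x; rewrite inE h.
have [b' bb'] := deg_gt0_adj (h1 b).
have sep x y : adj G x y -> (x \in Z) = (y \in Z).
  move=> xy; apply/idP/idP => [xZ|].
    by have := link_eq0 cZ xy xZ; rewrite inE negbK.
  by rewrite adj_sym in xy => yZ; have := link_eq0 cZ xy yZ; rewrite inE negbK.
have a'Z : a' \in Z by rewrite -(sep a) // HG.
have b'Z : b' \notin Z by rewrite -(sep b) // HG.
apply: (switch_fewer_cuts HG _ cZ aZ a'Z bZ b'Z) => //.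
- by apply: contra bZ => /sep <-.
- by apply: contra b'Z => /sep ->.
move=> W aW b'W a'W bW; apply: leq_trans (cut_ge_inside_both G Z W).
have : 1 < cut G (Z :&: W) by apply: nb; rewrite inE ?aZ // negb_and a'W orbT.
have : link G (Z :&: W) (~: Z) = 0.
  apply: link0 => x y /sep xy; rewrite inE => /andP [xZ _].
  by rewrite inE negbK -xy.
have : 0 < link G (~: Z :&: W) (~: Z :\: W).
  by apply: (link_gt0 (x := b') (y := b)); rewrite ?inE ?b'Z ?bZ ?bW // adj_sym HG.
rewrite cut_out => L0 -> ; rewrite addn0 => i2.
exact: (leq_add i2 L0).
Qed.

(** For a side [X] of a cut, and with [edge_connected l G], this says that [X] is
    inclusion-minimal among the sides of cuts of size [l]. *)
Definition atom l G X :=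
  cut G X = l /\
  forall S, S != set0 -> S \proper X -> l < cut G S.

Lemma atom_exists l G Z : edge_connected l G -> Z != set0 -> Z != setT ->
  cut G Z = l -> exists X, [/\ X \subset Z, X != set0 & atom l G X].
Proof.
move=> lG Z0 ZT cZ.
pose P S := [&& S \subset Z, S != set0 & cut G S == l].
have PZ : P Z by rewrite /P subxx Z0 cZ eqxx.
case: (arg_minnP (fun S : {set V} => #|S|) PZ) => X /and3P [XZ X0 /eqP cX] minX.
exists X; split=> //; split=> // S S0 SX.
have SZ : S \subset Z := subset_trans (proper_sub SX) XZ.
have ST : S != setT by apply: contraNneq ZT => h; rewrite h subTset in SZ.
rewrite ltn_neqAle (lG S S0 ST) andbT eq_sym; apply/negP => cS.
have := minX S; rewrite /P SZ S0 cS => /(_ isT).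
by rewrite leqNgt (proper_card SX).
Qed.

(** The two parts have cuts of size at least [l + 1], which count the edges between
    the parts twice and the [l] edges leaving [X] once. *)
Lemma atom_split l G X W x y : atom l G X ->
  x \in X :&: W -> y \in X :\: W ->
  [/\ l.+2 <= (link G (X :&: W) (X :\: W)).*2,
   l < cut G (X :&: W) & l < cut G (X :\: W)].
Proof.
move=> [cX mX] /[dup] xXW; rewrite inE => /andP [xX xW] /[dup] yXW.
rewrite inE => /andP [yW yX].
have : l < cut G (X :&: W).
  apply: mX; first by apply/set0Pn; exists x.
  apply/properP; split; first exact: subsetIl.
  by exists y; rewrite // inE negb_and yW orbT.
have : l < cut G (X :\: W).
  apply: mX; first by apply/set0Pn; exists y.
  apply/properP; split; first exact: subsetDl.
  by exists x; rewrite // inE xW.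
have := cut_split G X W; rewrite cX; split=> //; lia.
Qed.

(** In a split of an atom by as few edges as possible, each part receives exactly
    half of the edges leaving the atom: it needs that many for its own cut to
    exceed [l]. *)
Lemma tight_split_out l G X W x y : atom l G X ->
  x \in X :&: W -> y \in X :\: W ->
  (link G (X :&: W) (X :\: W)).*2 <= l.+2 ->
  (link G (X :&: W) (~: X)).*2 = l.
Proof.
move=> aX xW yW le; have [ge c1 c2] := atom_split aX xW yW.
have := out_split G X W; rewrite -setDE aX.1.
have := cut_out G X W; have := cut_out G X (~: W).
have -> : X :\: ~: W = X :&: W by rewrite setDE setCK.
rewrite -setDE (link_sym _ (X :\: W) (X :&: W)); clear -le ge c1 c2; lia.
Qed.

(** By submodularity the intersection and the union of two tight splits are tight
    splits.  Both are left by half of the edges leaving [X], so none of these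
    edges starts in the difference of the two. *)
Lemma tight_split_symdiff l G X W1 W2 x y : atom l G X ->
  x \in X -> x \in W1 -> x \in W2 -> y \in X -> y \notin W1 -> y \notin W2 ->
  (link G (X :&: W1) (X :\: W1)).*2 <= l.+2 ->
  (link G (X :&: W2) (X :\: W2)).*2 <= l.+2 ->
  link G (X :&: symdiff W1 W2) (~: X) = 0.
Proof.
move=> aX xX x1 x2 yX y1 y2 le1 le2.
have xI : x \in X :&: (W1 :&: W2) by rewrite !inE xX x1.
have yI : y \in X :\: (W1 :&: W2) by rewrite !inE yX (negbTE y1).
have xU : x \in X :&: (W1 :|: W2) by rewrite !inE xX x1.
have yU : y \in X :\: (W1 :|: W2) by rewrite !inE yX (negbTE y1) (negbTE y2).
have [geI _ _] := atom_split aX xI yI; have [geU _ _] := atom_split aX xU yU.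
have sub := inside_submod G X W1 W2.
have := tight_split_out aX xI yI; have := tight_split_out aX xU yU.
move: geI geU sub le1 le2; rewrite out_symdiff.
move: (link G _ _) (link G _ _) (link G _ _) (link G _ _) (link G _ _) (link G _ _).
clear; lia.
Qed.

(** Edges of [H] at interior vertices [a] and [b] of two disjoint atoms can be
    switched in two ways; if both were blocked by a cut of size [l + 2], there
    would be a set left by no edge. *)
Lemma connected_fewer_cuts l G H Z d :
  0 < l -> l < d -> spanning_subgraph H G -> (forall v, d <= deg G v) ->
  (forall v, 0 < deg H v) -> edge_connected l G ->
  Z != set0 -> Z != setT -> cut G Z = l -> has_fewer_cuts l G H.
Proof.
move=> l0 ld HG dG h1 lG Z0 ZT cZ.
have [X [XZ X0 aX]] := atom_exists lG Z0 ZT cZ.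
have Z0' : ~: Z != set0 by apply: contraNneq ZT => h; rewrite -(setCK Z) h setC0.
have ZT' : ~: Z != setT by apply: contraNneq Z0 => h; rewrite -(setCK Z) h setCT.
have [Y [YZ Y0 aY]] := atom_exists lG Z0' ZT' (etrans (cutC G Z) cZ).
have dXY : [disjoint X & Y].
  rewrite disjoints_subset (subset_trans XZ) //.
  by rewrite -(setCK Z) setCS.
have [cX _] := aX; have [cY _] := aY.
have [a aiX Na] : exists2 a, a \in X & forall w, adj G a w -> w \in X.
  by apply: interior_vertex X0 dG _; rewrite cX.
have [b biY Nb] : exists2 b, b \in Y & forall w, adj G b w -> w \in Y.
  by apply: interior_vertex Y0 dG _; rewrite cY.
have [a' aa'] := deg_gt0_adj (h1 a); have [b' bb'] := deg_gt0_adj (h1 b).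
have a'X := Na _ (HG _ _ aa'); have b'Y := Nb _ (HG _ _ bb').
have XY x : x \in X -> x \in Y = false by move=> ?; apply: (disjointFr dXY).
have YX x : x \in Y -> x \in X = false by move=> ?; apply: (disjointFl dXY).
have bN y : y \in Y -> ~~ adj G y a.
  by move=> yY; apply/negP; rewrite adj_sym => /Na; rewrite YX.
have aN x : x \in X -> ~~ adj G x b.
  by move=> xX; apply/negP; rewrite adj_sym => /Nb; rewrite XY.
have nX x : x \in Y -> x \notin X by move/YX->.
(* A cut that splits both atoms has at least [l + 2] edges.  If this bound is
   attained, both splits are tight and no edge elsewhere crosses. *)
have tight W x y z t : x \in X -> x \in W -> y \in X -> y \notin W ->
   z \in Y -> z \in W -> t \in Y -> t \notin W -> cut G W <= l + 2 ->
   [/\ (link G (X :&: W) (X :\: W)).*2 <= l.+2,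
       (link G (Y :&: W) (Y :\: W)).*2 <= l.+2 &
    forall u v, adj G u v -> ~~ ((u \in X) && (v \in X)) ->
       ~~ ((u \in Y) && (v \in Y)) -> (u \in W) = (v \in W)].
  move=> xX xW yX yW zY zW tY tW cW.
  have [| |gX _ _] := atom_split (W := W) (x := x) (y := y) aX.
  - by rewrite inE xX.
  - by rewrite inE yX yW.
  have [| |gY _ _] := atom_split (W := W) (x := z) (y := t) aY.
  - by rewrite inE zY.
  - by rewrite inE tY tW.
  have [iX iY s0] : [/\ (link G (X :&: W) (X :\: W)).*2 <= l.+2,
      (link G (Y :&: W) (Y :\: W)).*2 <= l.+2 &
      \sum_(p : V * V) crosses_off G X Y W p.1 p.2 = 0].
    move: gX gY cW; rewrite (cut_inside_disjoint G W dXY).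
    move: (link _ _ _) (link _ _ _) (\sum_p _) => i j s; clear.
    by move=> gX gY cW; split; lia.
  split=> //.
  have h u v : adj G u v -> ~~ ((u \in X) && (v \in X)) ->
       ~~ ((u \in Y) && (v \in Y)) -> (u \in W) -> (v \in W).
    move=> uv uvX uvY uW; apply: contraTT isT => vW.
    move/eqP: s0; rewrite sum_nat_eq0 => /forallP/(_ (u, v)) /=.
    by rewrite /crosses_off uv uvX uvY uW vW.
  move=> u v uv uvX uvY; apply/idP/idP; first exact: h.
  by apply: h; rewrite 1?adj_sym // andbC.
(* Try the switch to ab', a'b; [W1] is a cut that blocks it. *)
have [/forallP ok|] := boolP [forall W : {set V},
  [&& a \in W, b' \in W, a' \notin W & b \notin W] ==> (l + 3 <= cut G W)].
  apply: (switch_fewer_cuts HG lG cX aiX a'X (nX b biY) (nX b' b'Y)) => //.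
  - exact: aN.
  - exact: bN.
  by move=> W aW b'W a'W bW; have := ok W; rewrite aW b'W a'W bW.
rewrite negb_forall => /existsP [W1]; rewrite negb_imply -ltnNge.
case/andP=> /and4P [a1 b'1 a'1 b1] c1.
have [|tX1 tY1 in1] := tight W1 a a' b' b aiX a1 a'X a'1 b'Y b'1 biY b1;
  first by rewrite -ltnS -addnS.
(* An edge a'b' would cross [W1] outside [X] and [Y]; so it is absent, and the
   edges may be exchanged for ab, a'b' instead; [W2] is a cut blocking that. *)
have na'b' : ~~ adj G a' b'.
  apply/negP => /in1; rewrite a'X b'Y (XY a') // (YX b') // (negbTE a'1) b'1.
  by move/(_ isT isT).
have [/forallP ok|] := boolP [forall W : {set V},
  [&& a \in W, b \in W, a' \notin W & b' \notin W] ==> (l + 3 <= cut G W)].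
  apply: (switch_fewer_cuts HG lG cX aiX a'X (nX b' b'Y) (nX b biY)) => //.
  - by rewrite adj_sym.
  - exact: bN.
  by move=> W aW b'W a'W bW; have := ok W; rewrite aW b'W a'W bW.
rewrite negb_forall => /existsP [W2]; rewrite negb_imply -ltnNge.
case/andP=> /and4P [a2 b2 a'2 b'2] c2.
have [|tX2 tY2 in2] := tight W2 a a' b b' aiX a2 a'X a'2 biY b2 b'Y b'2;
  first by rewrite -ltnS -addnS.
exfalso.
(* In [Y], the roles of b and b' are interchanged between [W1] and [W2], so the
   complement of [W2] is the one to compare with [W1]. *)
have oX := tight_split_symdiff aX aiX a1 a2 a'X a'1 a'2 tX1 tX2.
have oY : link G (Y :&: symdiff W1 (~: W2)) (~: Y) = 0.
  apply: (tight_split_symdiff aY b'Y b'1 _ biY b1) => //; rewrite ?inE ?negbK //.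
  by rewrite -setDE link_sym setDE setCK.
have eX x y : adj G x y -> x \in X -> y \notin X -> (x \in W1) = (x \in W2).
  move=> xy xX yX; have := link_eq0 oX xy; rewrite !inE xX yX /=.
  by case: (x \in W1); case: (x \in W2) => //= /(_ isT).
have eY x y : adj G x y -> x \in Y -> y \notin Y -> (x \in W1) != (x \in W2).
  move=> xy xY yY; have := link_eq0 oY xy; rewrite !inE xY yY /=.
  by case: (x \in W1); case: (x \in W2) => //= /(_ isT).
(* Outside [X] and [Y], an edge has both ends on the same side of [W1] and of
   [W2].  An edge leaving [X] starts where [W1] and [W2] agree, as they do on
   its other end, and one leaving [Y] starts where they differ. *)
pose M := Y :|: (symdiff W1 W2 :\: X).
have : 0 < cut G M.
  apply: leq_trans l0 (lG M _ _).
    by apply/set0Pn; exists b; rewrite !inE biY.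
  by apply/negP=> /eqP /setP/(_ a); rewrite !inE XY // aiX.
rewrite /cut link0 // => x y xy.
rewrite !inE negbK => xM.
case yY: (y \in Y) => //=.
have xX : x \notin X by case/orP: xM => [/nX|/andP []].
have e1 : (x \in W1) = (y \in W1).
  by apply: in1; rewrite // ?(negbTE xX) // yY andbF.
have e2 : (x \in W2) = (y \in W2).
  by apply: in2; rewrite // ?(negbTE xX) // yY andbF.
have d12 : (x \in W1) != (x \in W2).
  case/orP: xM => [xY|/andP [_]]; first by apply: (eY x y) => //; rewrite yY.
  by case: (x \in W1); case: (x \in W2).
have yX : y \notin X.
  apply: contra d12 => yX; rewrite e1 e2; apply/eqP; apply: (eX y x) => //.
  by rewrite adj_sym.
by rewrite yX -e1 -e2 /=; case: (x \in W1) d12; case: (x \in W2).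
Qed.

(** * Raising the edge-connectivity *)

(** Improvement steps are repeated until no cut of size [l] is left. *)
Lemma raise_edge_connectivity_by_one l d G H :
  spanning_subgraph H G -> (forall v, d <= deg G v) ->
  (forall v, 1 < deg G v) -> (forall v, 0 < deg H v) -> l < d ->
  edge_connected l G ->
  exists G' H', [/\ deg G' =1 deg G, deg H' =1 deg H,
    spanning_subgraph H' G' & edge_connected l.+1 G'].
Proof.
move=> + + + + ld.
have [m] := ubnP #|cuts_of_size l G|; elim: m G H => // m IH G H cm HG dG d2 h1 lG.
have [c0|[Z]] := set_0Vmem (cuts_of_size l G).
  exists G, H; split=> // W W0 WT; rewrite ltn_neqAle lG // andbT eq_sym.
  apply/negP => cW; suff : W \in cuts_of_size l G by rewrite c0 inE.
  by rewrite inE W0 WT.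
rewrite inE => /and3P [Z0 ZT /eqP cZ].
have [G' [H' [eG eH HG' lG' lt]]] : has_fewer_cuts l G H.
  case: (posnP l) => [l0|l0]; last exact: (connected_fewer_cuts l0 ld _ _ _ _ Z0 ZT).
  by rewrite l0; apply: (disconnected_fewer_cuts HG d2 h1 Z0 ZT); rewrite cZ.
have [||||G2 [H2 [eG2 eH2 HG2 lG2]]] := IH G' H' _ HG' _ _ _ lG'.
- by apply: leq_trans lt _; rewrite -ltnS.
- by move=> v; rewrite eG.
- by move=> v; rewrite eG.
- by move=> v; rewrite eH.
exists G2, H2; split=> //.
  by move=> v; rewrite eG2 eG.
by move=> v; rewrite eH2 eH.
Qed.

Lemma raise_edge_connectivity d G H :
  spanning_subgraph H G -> (forall v, d <= deg G v) ->
  (forall v, 1 < deg G v) -> (forall v, 0 < deg H v) ->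
  exists G' H', [/\ deg G' =1 deg G, deg H' =1 deg H,
    spanning_subgraph H' G' & edge_connected d G'].
Proof.
move=> HG dG d2 h1.
suff: forall l, l <= d -> exists G' H', [/\ deg G' =1 deg G, deg H' =1 deg H,
    spanning_subgraph H' G' & edge_connected l G'] by apply.
elim=> [|l IH] ld; first by exists G, H; split.
have [G' [H' [eG eH HG' lG']]] := IH (ltnW ld).
have [|||G2 [H2 [eG2 eH2 HG2 lG2]]] := raise_edge_connectivity_by_one HG' _ _ _ ld lG'.
- by move=> v; rewrite eG.
- by move=> v; rewrite eG.
- by move=> v; rewrite eH.
exists G2, H2; split=> //.
  by move=> v; rewrite eG2 eG.
by move=> v; rewrite eH2 eH.
Qed.

(** * Edge-connectivity and cuts *)

Lemma bigmin_le (I : finType) (P : pred I) (F : I -> nat) x i :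
  P i -> \big[minn/x]_(j | P j) F j <= F i.
Proof.
have := mem_index_enum i; elim: (index_enum I) => //= j s IH.
rewrite inE big_cons => /orP [/eqP <-|/IH h] Pi.
  by rewrite Pi geq_minl.
by case: (P j); rewrite ?geq_min ?h ?orbT.
Qed.

Lemma le_bigmin (I : finType) (P : pred I) (F : I -> nat) x m :
  m <= x -> (forall i, P i -> m <= F i) -> m <= \big[minn/x]_(j | P j) F j.
Proof.
by move=> mx mF; elim/big_ind: _ => // y z my mz; rewrite leq_min my.
Qed.

Definition cut_edges G W : {set {set V}} :=
  [set [set p.1; p.2] | p : V * V & [&& adj G p.1 p.2, p.1 \in W & p.2 \notin W]].

Lemma card_cut_edges G W : #|cut_edges G W| = cut G W.
Proof.
rewrite card_in_imset => [|[x y] [z t] /=].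
  rewrite -sum1dep_card [LHS]big_mkcond; apply: eq_bigr => p _ /=.
  by rewrite !inE; case: (adj _ _ _); case: (p.1 \in W); case: (p.2 \in W).
rewrite !inE /= => /and3P [_ xW yW] /and3P [_ zW tW] /setP e.
have := e x; have := e y; rewrite !inE !eqxx ?orbT.
have -> : (y == z) = false by apply: contraNF yW => /eqP ->.
have -> : (x == t) = false by apply: contraNF tW => /eqP <-.
by rewrite orbF /= => /esym/eqP -> /esym/eqP ->.
Qed.

Lemma cut_edges_sub G W : cut_edges G W \subset edges G.
Proof.
by apply/imsetS/subsetP => p; rewrite !inE => /and3P [].
Qed.

(** Take as [W] the component of a vertex once [S] is deleted: all edges leaving
    [W] are in [S]. *)
Lemma disconnecting_cut G (S : {set {set V}}) :
  S \subset edges G -> ~~ connected (del_edges G S) ->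
  exists W, [/\ W != set0, W != setT & cut G W <= #|S|].
Proof.
move=> SE; rewrite negb_forall => /existsP [x]; rewrite negb_forall => /existsP [y nxy].
exists [set z | connect (adj (del_edges G S)) x z]; split.
- by apply/set0Pn; exists x; rewrite inE connect0.
- by apply/negP => /eqP/setP/(_ y); rewrite !inE (negbTE nxy).
rewrite -card_cut_edges; apply/subset_leq_card/subsetP => _ /imsetP [[u v] + ->].
rewrite !inE /= => /and3P [uv xu xv]; apply: contraNT xv => uvS.
by apply: connect_trans xu (connect1 _); rewrite /= /del_adj uv.
Qed.

Lemma cut_edges_disconnecting G W : W != set0 -> W != setT ->
  ~~ connected (del_edges G (cut_edges G W)).
Proof.
move=> /set0Pn [x xW] WT; have [y yW] : exists y, y \notin W.
  by apply/existsP; rewrite -negb_forall; apply: contra WT => /forallP h;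
   apply/eqP/setP => x'; rewrite inE h.
apply: contra yW => /forallP/(_ x)/forallP/(_ y) xy.
suff cl : closed (adj (del_edges G (cut_edges G W))) (mem W).
  by have := closed_connect cl xy; rewrite xW => <-.
move=> u v /=; rewrite /del_adj => /andP [uv nuv].
apply/idP/idP => [uW|vW]; apply: contraNT nuv => nW; apply/imsetP.
  by exists (u, v); rewrite // inE uv uW.
by exists (v, u); rewrite ?inE /= 1?adj_sym ?uv ?vW // setUC.
Qed.

Lemma cut1 G v : cut G [set v] = deg G v.
Proof.
rewrite deg_link /cut /link; apply: eq_bigr => -[x y] _ /=; rewrite !inE.
case: (x =P v) => [->|_]; last by rewrite !andbF.
by case: (y =P v) => [->|_]; rewrite ?adj_irrefl.
Qed.

Lemma min_degree_le G v : min_degree G <= deg G v.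
Proof. exact: bigmin_le. Qed.

(** The star of any vertex is a disconnecting set, so the edge-connectivity never
    exceeds the minimum degree; conversely a disconnecting set contains a cut. *)
Lemma edge_connected_maximally G :
  (forall v, 0 < deg G v) -> edge_connected (min_degree G) G ->
  maximally_edge_connected G.
Proof.
move=> d1 dG; apply/eqP; rewrite eqn_leq; apply/andP; split; last first.
  apply: le_bigmin => [|S /andP [SE nS]]; last first.
    by have [W [W0 WT]] := disconnecting_cut SE nS; apply/leq_trans/dG.
  case: (pickP V) => [v _|V0].
    apply: leq_trans (min_degree_le G v) _.
    by rewrite -cut1 -card_cut_edges subset_leq_card ?cut_edges_sub.
  have -> : min_degree G = #|V| by apply: big_pred0 => v; have := V0 v.
  by rewrite (_ : #|V| = 0) //; apply: eq_card0 => v; have := V0 v.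
have le_deg v : edge_connectivity G <= deg G v.
  rewrite -cut1 -card_cut_edges; apply: bigmin_le.
  rewrite cut_edges_sub cut_edges_disconnecting //.
    by apply/set0Pn; exists v; rewrite inE.
  have [w vw] := deg_gt0_adj (d1 v).
  by apply/negP => /eqP/setP/(_ w); rewrite !inE => /eqP e; rewrite e adj_irrefl in vw.
apply: le_bigmin => [|v _]; last exact: le_deg.
case: (pickP V) => [v _|V0]; first exact: leq_trans (le_deg v) (max_card _).
apply: (@leq_trans #|edges G|).
  by rewrite /edge_connectivity; elim/big_rec: _ => // S y _; apply/leq_trans/geq_minr.
by apply: leq_trans (leq_imset_card _ _) _; rewrite eq_card0 // => -[x]; have := V0 x.
Qed.

End FactorConnectivity.

(** * Maximally edge-connected realizations with a prescribed factor *)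

Local Open Scope ring_scope.

Theorem theorem5 (n : nat) (k : int) (d kk : 'I_n -> int)
  (hk : 1 <= k)
  (hd : graphic d)
  (hdk : graphic (fun i => d i - kk i))
  (hd2 : forall i, 2 <= d i)
  (hkk : forall i, k <= kk i <= k + 1) :
  exists G : sgraph 'I_n,
    [/\ realization d G, maximally_edge_connected G & has_factor kk G].
Proof.
case: hd => G0 rG0; case: hdk => F0 rF0.
have [||G1 [F1 [eG1 eF1 FG1]]] := @kundu_k_factor _ `|k|%N (fun i => `|kk i|%N) G0 F0.
- by move=> i; have := hkk i; lia.
- move=> i /=; have := rG0 i; have /= := rF0 i; have := hkk i.
  by move: (deg F0 i) (deg G0 i) (kk i) (d i) => *; lia.
have H1 i : Posz (deg (diff G1 F1) i) = kk i.
  have := deg_diff i FG1; rewrite eG1 eF1.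
  have := rG0 i; have /= := rF0 i; have := hkk i.
  move: (deg F0 i) (deg G0 i) (deg (diff G1 F1) i) (kk i) (d i) => *; lia.
have deg2 i : (1 < deg G1 i)%N by rewrite eG1 -lez_nat rG0.
have [||||G [H [eG eH HG cG]]] :=
  @raise_edge_connectivity _ (min_degree G1) G1 (diff G1 F1).
- by move=> x y /andP [].
- exact: min_degree_le.
- exact: deg2.
- by move=> i; rewrite -lez_nat H1; have := hkk i; lia.
exists G; split.
- by move=> i; rewrite eG eG1.
- apply: edge_connected_maximally => [v|]; first by rewrite eG ltnW.
  suff -> : min_degree G = min_degree G1 by [].
  by apply: eq_bigr => v _; rewrite eG.
- by exists H; split=> // i; rewrite eH H1.
Qed.
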